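(* For all integers $m,n\ge1$, every $\Psi:\mathbb{Z}^n\to\mathbb{R}_{>0}$ and each $\circ\in\{\ ,\ ',\ ''\}$, the set $\mathcal{W}^\circ_{n,m}(\Psi)=\bigcap_{k=1}^\infty\mathcal{A}^\circ_{n,m}(k^{-1}\Psi)$ has the same Lebesgue measure as $\mathcal{A}^\circ_{n,m}(\Psi)$.
   Context: Let $m,n\ge1$ be integers. Points $\mathbf{X}\in[0,1]^{nm}$ are regarded as real $n\times m$ matrices, $\mathbf{q}\in\mathbb{Z}^n$ as a row vector, so $\mathbf{q}\mathbf{X}\in\mathbb{R}^m$; $|\cdot|$ denotes the supremum norm on $\mathbb{R}^m$. For $\Psi:\mathbb{Z}^n\to\mathbb{R}_{>0}$ consider the inequality ( * ) $|\mathbf{q}\mathbf{X}+\mathbf{p}|<\Psi(\mathbf{q})$, with $\mathbf{p}=(p_1,\dots,p_m)\in\mathbb{Z}^m$, $\mathbf{q}\in\mathbb{Z}^n\setminus\{\mathbf{0}\}$. $\mathcal{A}_{n,m}(\Psi)$ is the set of $\mathbf{X}\in[0,1]^{nm}$ for which ( * ) holds for infinitely many pairs $(\mathbf{p},\mathbf{q})$; $\mathcal{A}'_{n,m}(\Psi)$ is the set of $\mathbf{X}\in[0,1]^{nm}$ for which ( * ) holds for infinitely many $(\mathbf{p},\mathbf{q})$ with $\gcd(\mathbf{p},\mathbf{q})=1$ (the gcd of all components of $\mathbf{p}$ and $\mathbf{q}$); $\mathcal{A}''_{n,m}(\Psi)$ is the set of $\mathbf{X}\in[0,1]^{nm}$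 for which ( * ) holds for infinitely many $(\mathbf{p},\mathbf{q})$ with $\gcd(p_j,\mathbf{q})=1$ for every $j=1,\dots,m$. $\mathcal{A}^\circ_{n,m}$ denotes any one of $\mathcal{A}_{n,m},\mathcal{A}'_{n,m},\mathcal{A}''_{n,m}$, and $k^{-1}\Psi$ is the function $\mathbf{q}\mapsto \Psi(\mathbf{q})/k$. *)

(* Defs.v *)
From Stdlib Require Import Reals ZArith List.
Open Scope R_scope.

Fixpoint sumR (n : nat) (f : nat -> R) : R :=
  match n with O => 0 | S k => sumR k f + f k end.
Fixpoint prodR (n : nat) (f : nat -> R) : R :=
  match n with O => 1 | S k => prodR k f * f k end.

(** Points of R^d are functions nat -> R; only coordinates k < d matter. *)

Definition box_vol (d : nat) (a b : nat -> nat -> R) (l : nat) : R :=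
  prodR d (fun k => Rmax 0 (b l k - a l k)).

Definition box_cover (d : nat) (a b : nat -> nat -> R) (S : (nat -> R) -> Prop) : Prop :=
  forall x, S x -> exists l : nat, forall k, (k < d)%nat -> a l k <= x k <= b l k.

Definition lebesgue_outer_le (d : nat) (S : (nat -> R) -> Prop) (c : R) : Prop :=
  forall eps, 0 < eps ->
    exists a b : nat -> nat -> R, box_cover d a b S /\
      forall N, sum_f_R0 (box_vol d a b) N <= c + eps.

(** Two sets have the same Lebesgue (outer) measure, as values in [0, +oo]. *)
Definition same_lebesgue_measure (d : nat) (S T : (nat -> R) -> Prop) : Prop :=
  forall c : R, lebesgue_outer_le d S c <-> lebesgue_outer_le d T c.

(** The n x m matrix X encoded in a point x of R^(n*m): X i j = x (i*m + j). *)
Definition mat_entry (m : nat) (x : nat -> R) (i j : nat) : R := x (i * m + j)%nat.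

Definition in_unit_cube (d : nat) (x : nat -> R) : Prop :=
  forall k, (k < d)%nat -> 0 <= x k <= 1.

Definition qX (n m : nat) (q : list Z) (x : nat -> R) (j : nat) : R :=
  sumR n (fun i => IZR (nth i q 0%Z) * mat_entry m x i j).

Definition gcd_list (l : list Z) : Z := fold_right Z.gcd 0%Z l.

Inductive variant := Plain | Prime | DPrime.

Definition coprime_cond (v : variant) (p q : list Z) : Prop :=
  match v with
  | Plain => True
  | Prime => gcd_list (p ++ q) = 1%Z
  | DPrime => forall j, (j < length p)%nat -> gcd_list (nth j p 0%Z :: q) = 1%Z
  end.

Definition solution (v : variant) (n m : nat) (Psi : list Z -> R)
    (x : nat -> R) (pq : list Z * list Z) : Prop :=
  let (p, q) := pq in
  length p = m /\ length q = n /\ Exists (fun z => z <> 0%Z) q /\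
  (forall j, (j < m)%nat -> Rabs (qX n m q x j + IZR (nth j p 0%Z)) < Psi q) /\
  coprime_cond v p q.

Definition infinitely_many {T : Type} (P : T -> Prop) : Prop :=
  forall L : list T, exists t, ~ In t L /\ P t.

Definition Aset (v : variant) (n m : nat) (Psi : list Z -> R) (x : nat -> R) : Prop :=
  in_unit_cube (n * m) x /\ infinitely_many (solution v n m Psi x).

Definition Wset (v : variant) (n m : nat) (Psi : list Z -> R) (x : nat -> R) : Prop :=
  forall k : nat, (1 <= k)%nat -> Aset v n m (fun q => Psi q / INR k) x.

(* Main.v *)
(* The set A \ W is the countable union of the sets E_N of points X of A(Psi) all of whose solutions for Psi / N have height at most N, so it suffices that each E_N is null.
   Suppose first that Psi(q) / |q| tends to 0. A point X of E_N lies within r = Psi(q) / |q| of the affine subspace q Y + p = 0 for some (p, q) of large height, and E_N avoids a ball of radius comparable to r centred on that subspace. Hence E_N has holes of proportional size near each of its points, at arbitrarily small scales. For an odd base b, b-adic grids and their translates by 1/2 trap the point and its hole in a common cube; as every such cube loses a fixed proportion of its volume, E_N is null.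
   Otherwise Psi(q) >= eta |q| for infinitely many q. Every interval of length eps d contains an integer coprime to d once d is large, so that for such q one can choose p with every p_j coprime to q, and E_N is empty. *)
Require Import Defs.
From Stdlib Require Import Reals ZArith List.
From Stdlib Require Import Lra Lia Psatz Classical ClassicalEpsilon IndefiniteDescription.
From Stdlib Require Import Cantor Znumtheory Zpow_facts.
Open Scope R_scope.

(** * Finite sums and covers by boxes *)

Lemma sumR_ext (N : nat) (f g : nat -> R) :
  (forall i, (i < N)%nat -> f i = g i) -> sumR N f = sumR N g.
Proof.
  induction N as [|N IH]; intros H; simpl; [reflexivity|].
  rewrite IH, H; auto with arith.
Qed.

Lemma sumR_le (N : nat) (f g : nat -> R) :
  (forall i, (i < N)%nat -> f i <= g i) -> sumR N f <= sumR N g.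
Proof.
  induction N as [|N IH]; intros H; simpl; [lra|].
  apply Rplus_le_compat; auto with arith.
Qed.

Lemma sumR_const (N : nat) (c : R) : sumR N (fun _ => c) = INR N * c.
Proof.
  induction N as [|N IH]; [simpl; ring|].
  rewrite S_INR; simpl; rewrite IH; ring.
Qed.

Lemma sumR_plus (N : nat) (f g : nat -> R) :
  sumR N (fun i => f i + g i) = sumR N f + sumR N g.
Proof. induction N as [|N IH]; simpl; [ring|rewrite IH; ring]. Qed.

Lemma sumR_scal (N : nat) (c : R) (f : nat -> R) :
  sumR N (fun i => c * f i) = c * sumR N f.
Proof. induction N as [|N IH]; simpl; [ring|rewrite IH; ring]. Qed.

Lemma sumR_abs (N : nat) (f : nat -> R) :
  Rabs (sumR N f) <= sumR N (fun i => Rabs (f i)).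
Proof.
  induction N as [|N IH]; simpl; [rewrite Rabs_R0; lra|].
  eapply Rle_trans; [apply Rabs_triang|lra].
Qed.

Lemma sumR_le_length (N N' : nat) (f : nat -> R) :
  (forall i, 0 <= f i) -> (N <= N')%nat -> sumR N f <= sumR N' f.
Proof.
  intros Hf; induction 1 as [|N' _ IH]; simpl; [lra|].
  specialize (Hf N'); lra.
Qed.

Lemma sumR_app (N N' : nat) (f : nat -> R) :
  sumR (N + N') f = sumR N f + sumR N' (fun i => f (N + i)%nat).
Proof.
  induction N' as [|N' IH]; [rewrite Nat.add_0_r; simpl; ring|].
  rewrite Nat.add_succ_r; simpl; rewrite IH; ring.
Qed.

Lemma sumR_exchange (N N' : nat) (f : nat -> nat -> R) :
  sumR N (fun i => sumR N' (f i)) = sumR N' (fun j => sumR N (fun i => f i j)).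
Proof.
  induction N as [|N IH]; simpl.
  - rewrite sumR_const; ring.
  - rewrite IH, <- sumR_plus; reflexivity.
Qed.

(** Splitting by residues separates two interleaved covers when [M = 2], and sorts words by first
    letter when [M] is the size of the alphabet. *)
Lemma sumR_mul_length (M N : nat) (f : nat -> R) :
  sumR (M * N) f = sumR M (fun a => sumR N (fun l => f (a + M * l)%nat)).
Proof.
  rewrite sumR_exchange.
  induction N as [|N IH]; [rewrite Nat.mul_0_r; reflexivity|].
  rewrite Nat.mul_succ_r, sumR_app, IH; simpl; f_equal.
  apply sumR_ext; intros i _; f_equal; lia.
Qed.

Lemma sum_f_R0_sumR (f : nat -> R) (N : nat) : sum_f_R0 f N = sumR (S N) f.
Proof.
  induction N as [|N IH]; [simpl; ring|].
  simpl sum_f_R0; rewrite IH; reflexivity.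
Qed.

Lemma prodR_const (d : nat) (c : R) : prodR d (fun _ => c) = c ^ d.
Proof. induction d as [|d IH]; simpl; [reflexivity|rewrite IH; ring]. Qed.

Lemma prodR_ext (d : nat) (f g : nat -> R) :
  (forall k, (k < d)%nat -> f k = g k) -> prodR d f = prodR d g.
Proof.
  induction d as [|d IH]; intros H; simpl; [reflexivity|].
  rewrite IH, H; auto with arith.
Qed.

Lemma prodR_nonneg (d : nat) (f : nat -> R) : (forall k, 0 <= f k) -> 0 <= prodR d f.
Proof.
  intros H; induction d as [|d IH]; simpl; [lra|].
  apply Rmult_le_pos; auto.
Qed.

Lemma box_vol_nonneg (d : nat) (a b : nat -> nat -> R) (l : nat) : 0 <= box_vol d a b l.
Proof. apply prodR_nonneg; intros; apply Rmax_l. Qed.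

Definition null_set (d : nat) (S : (nat -> R) -> Prop) : Prop := lebesgue_outer_le d S 0.

Lemma lebesgue_outer_le_subset (d : nat) (S T : (nat -> R) -> Prop) (c : R) :
  (forall x, S x -> T x) -> lebesgue_outer_le d T c -> lebesgue_outer_le d S c.
Proof.
  intros HST HT eps Heps; destruct (HT eps Heps) as (a & b & Hc & Hv).
  exists a, b; split; [intros x Hx; apply Hc, HST, Hx|exact Hv].
Qed.

Lemma lebesgue_outer_le_null_union (d : nat) (X Y : (nat -> R) -> Prop) (c : R) :
  lebesgue_outer_le d X c -> null_set d Y ->
  lebesgue_outer_le d (fun x => X x \/ Y x) c.
Proof.
  intros HS HT eps Heps.
  destruct (HS (eps / 2)) as (a & b & Hc & Hv); [lra|].
  destruct (HT (eps / 2)) as (a' & b' & Hc' & Hv'); [lra|].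
  (* The covers are interleaved, that of [X] at even and that of [Y] at odd indices. *)
  set (mix := fun (f g : nat -> nat -> R) l => if Nat.even l then f (l / 2)%nat else g (l / 2)%nat).
  assert (E0 : forall f g l, mix f g (0 + 2 * l)%nat = f l).
  { intros f g l; unfold mix; replace (0 + 2 * l)%nat with (2 * l)%nat by lia.
    rewrite Nat.even_mul, (Nat.mul_comm 2), Nat.div_mul by lia; reflexivity. }
  assert (E1 : forall f g l, mix f g (1 + 2 * l)%nat = g l).
  { intros f g l; unfold mix; rewrite Nat.even_add, Nat.even_mul; simpl orb; simpl Bool.eqb.
    f_equal; rewrite (Nat.mul_comm 2), Nat.div_add by lia; reflexivity. }
  exists (mix a a'), (mix b b'); split.
  - intros x [Hx|Hx].
    + destruct (Hc x Hx) as [l Hl]; exists (0 + 2 * l)%nat; rewrite !E0; exact Hl.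
    + destruct (Hc' x Hx) as [l Hl]; exists (1 + 2 * l)%nat; rewrite !E1; exact Hl.
  - intros N; rewrite sum_f_R0_sumR.
    eapply Rle_trans.
    { apply (sumR_le_length _ (2 * S N)); [intros; apply box_vol_nonneg|lia]. }
    rewrite sumR_mul_length.
    assert (H2 : forall g, sumR 2 g = g 0%nat + g 1%nat) by (intros; simpl; ring).
    rewrite H2.
    specialize (Hv N); specialize (Hv' N); rewrite sum_f_R0_sumR in Hv, Hv'.
    rewrite (sumR_ext (S N) (fun l => box_vol _ _ _ (0 + 2 * l)%nat) (box_vol d a b)).
    2: { intros l _; unfold box_vol; rewrite !E0; reflexivity. }
    rewrite (sumR_ext (S N) (fun l => box_vol _ _ _ (1 + 2 * l)%nat) (box_vol d a' b')).
    2: { intros l _; unfold box_vol; rewrite !E1; reflexivity. }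
    lra.
Qed.

Definition sum_list {T : Type} (f : T -> R) (l : list T) : R :=
  fold_right (fun t s => f t + s) 0 l.

Lemma sum_list_app {T : Type} (f : T -> R) (l l' : list T) :
  sum_list f (l ++ l') = sum_list f l + sum_list f l'.
Proof. induction l as [|t l IH]; simpl; [ring|rewrite IH; ring]. Qed.

Lemma sum_list_nonneg {T : Type} (f : T -> R) (l : list T) :
  (forall t, 0 <= f t) -> 0 <= sum_list f l.
Proof. intros H; induction l as [|t l IH]; simpl; [lra|specialize (H t); lra]. Qed.

Lemma sum_list_incl {T : Type} (f : T -> R) (l l' : list T) :
  (forall t, 0 <= f t) -> NoDup l -> incl l l' -> sum_list f l <= sum_list f l'.
Proof.
  intros Hf Hl; revert l'; induction Hl as [|t l Ht _ IH]; intros l' Hi; simpl.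
  - apply sum_list_nonneg, Hf.
  - destruct (in_split t l') as (l1 & l2 & ->); [apply Hi; left; reflexivity|].
    rewrite sum_list_app; simpl.
    enough (sum_list f l <= sum_list f (l1 ++ l2)) by (rewrite sum_list_app in *; lra).
    apply IH; intros u Hu.
    assert (Hu' : In u (l1 ++ t :: l2)) by (apply Hi; right; exact Hu).
    apply in_app_or in Hu'; apply in_or_app; destruct Hu' as [?|[->|?]]; tauto.
Qed.

Lemma sum_list_map_seq {T : Type} (f : T -> R) (g : nat -> T) (N : nat) :
  sum_list f (map g (seq 0 N)) = sumR N (fun l => f (g l)).
Proof.
  induction N as [|N IH]; [reflexivity|].
  rewrite seq_S, map_app, sum_list_app, IH; simpl; ring.
Qed.

Lemma sum_list_list_prod (f : nat * nat -> R) (l l' : list nat) :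
  sum_list f (list_prod l l') = sum_list (fun i => sum_list (fun t => f (i, t)) l') l.
Proof.
  induction l as [|i l IH]; simpl; [reflexivity|].
  rewrite sum_list_app, IH; f_equal; clear IH.
  induction l' as [|t l' IH]; simpl; [reflexivity|rewrite <- IH; reflexivity].
Qed.

(** Distinct codes decode to distinct pairs, and both components of a pair are at most its code, so
    the first [N] codes fall inside an [N] by [N] square. *)
Lemma sumR_cantor_le (f : nat * nat -> R) (N : nat) :
  (forall t, 0 <= f t) ->
  sumR N (fun l => f (Cantor.of_nat l)) <= sumR N (fun i => sumR N (fun t => f (i, t))).
Proof.
  intros Hf; rewrite <- (sum_list_map_seq f).
  transitivity (sum_list f (list_prod (seq 0 N) (seq 0 N))).
  - apply sum_list_incl; [exact Hf| |].
    + apply NoDup_map_NoDup_ForallPairs; [|apply seq_NoDup].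
      intros i j _ _ H; rewrite <- (Cantor.cancel_to_of i), H; apply Cantor.cancel_to_of.
    + intros [i t] H; apply in_map_iff in H; destruct H as (l & Hl & Hin).
      apply in_seq in Hin.
      pose proof (Cantor.to_nat_non_decreasing i t) as Hle.
      rewrite <- Hl, Cantor.cancel_to_of in Hle.
      apply in_prod; apply in_seq; lia.
  - rewrite sum_list_list_prod, <- (map_id (seq 0 N)) at 1.
    rewrite sum_list_map_seq; apply sumR_le; intros i _.
    rewrite <- (map_id (seq 0 N)), sum_list_map_seq; lra.
Qed.

Lemma sumR_geom_half (N : nat) : sumR N (fun i => (/ 2) ^ S i) <= 1.
Proof.
  assert (H : sumR N (fun i => (/ 2) ^ S i) = 1 - (/ 2) ^ N).
  { induction N as [|N IH]; [simpl; ring|].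
    cbn [sumR]; rewrite IH; simpl; field. }
  rewrite H; assert (0 < (/ 2) ^ N) by (apply pow_lt; lra); lra.
Qed.

Lemma null_set_countable_union (d : nat) (X : nat -> (nat -> R) -> Prop) :
  (forall i, null_set d (X i)) -> null_set d (fun x => exists i, X i x).
Proof.
  intros HS eps Heps.
  (* The set [X i] is allowed the error [eps / 2 ^ (i + 1)]; these errors add up to at most
     [eps]. *)
  assert (He : forall i, 0 < eps * (/ 2) ^ S i).
  { intros i; apply Rmult_lt_0_compat; [exact Heps|apply pow_lt; lra]. }
  destruct (functional_choice (fun i (ab : (nat -> nat -> R) * (nat -> nat -> R)) =>
    box_cover d (fst ab) (snd ab) (X i) /\
    forall N, sum_f_R0 (box_vol d (fst ab) (snd ab)) N <= 0 + eps * (/ 2) ^ S i)) as [ab Hab].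
  { intros i; destruct (HS i _ (He i)) as (a & b & H); exists (a, b); exact H. }
  set (a := fun i => fst (ab i)); set (b := fun i => snd (ab i)).
  exists (fun l => let (i, t) := Cantor.of_nat l in a i t),
         (fun l => let (i, t) := Cantor.of_nat l in b i t); split.
  - intros x [i Hx]; destruct (proj1 (Hab i) x Hx) as [t Ht].
    exists (Cantor.to_nat (i, t)); rewrite Cantor.cancel_of_to; exact Ht.
  - intros N; rewrite sum_f_R0_sumR.
    set (f := fun u : nat * nat => box_vol d (a (fst u)) (b (fst u)) (snd u)).
    rewrite (sumR_ext _ _ (fun l => f (Cantor.of_nat l))).
    2: { intros l _; unfold f, box_vol; destruct (Cantor.of_nat l); reflexivity. }
    eapply Rle_trans; [apply sumR_cantor_le; intros t; apply (box_vol_nonneg d (a (fst t)) (b (fst t)))|].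
    eapply Rle_trans.
    { apply sumR_le; intros i _; unfold f; cbn [fst snd].
      rewrite <- sum_f_R0_sumR; apply (proj2 (Hab i)). }
    rewrite (sumR_ext _ _ (fun i => eps * (/ 2) ^ S i)) by (intros; ring).
    rewrite sumR_scal; pose proof (sumR_geom_half (S N)); nra.
Qed.

(** * Trees of B-adic cubes with holes *)

(* Bijective base-M numeration. It is self-similar, so that a sum over the first N words splits along the first letter. *)
Lemma word_numeration (M : nat) : (1 <= M)%nat ->
  exists wd : nat -> list nat, wd 0%nat = nil /\
    forall a l, (a < M)%nat -> wd (S (a + M * l)) = a :: wd l.
Proof.
  intros HM.
  (* Word number [S n'] has first letter [n' mod M] and continues with word number [n' / M]. The
     argument [f] is fuel; as [n' / M <= n'], fuel [n] suffices for word [n]. *)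
  set (wdf := fix wdf (f n : nat) : list nat :=
    match f, n with
    | S f', S n' => (n' mod M)%nat :: wdf f' (n' / M)%nat
    | _, _ => nil
    end).
  assert (Hf : forall f n, (n <= f)%nat -> wdf f n = wdf n n).
  { intros f; induction f as [f IH] using lt_wf_ind; intros n Hn.
    destruct n as [|n]; [destruct f; reflexivity|].
    destruct f as [|f]; [lia|]; simpl; f_equal.
    assert (n / M <= n)%nat by (apply Nat.Div0.div_le_upper_bound; nia).
    rewrite (IH f) by lia; symmetry; apply IH; lia. }
  exists (fun n => wdf n n); split; [reflexivity|].
  intros a l Ha; simpl.
  rewrite (Nat.mul_comm M), Nat.Div0.mod_add, Nat.mod_small, Nat.div_add, Nat.div_small by lia.
  f_equal; apply Hf; simpl; nia.
Qed.

Lemma word_numeration_onto (M : nat) (wd : nat -> list nat) (w : list nat) :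
  wd 0%nat = nil -> (forall a l, (a < M)%nat -> wd (S (a + M * l)) = a :: wd l) ->
  Forall (fun a => (a < M)%nat) w -> exists l, wd l = w.
Proof.
  intros H0 HS; induction 1 as [|a w Ha _ [l Hl]]; [exists 0%nat; exact H0|].
  exists (S (a + M * l)); rewrite HS, Hl; auto.
Qed.

(** Base-[B] numerals, least significant digit first: a number below [B ^ d] stands for the position
    of a child cube. With base 2 the same code later lists the choices of a root. *)
Fixpoint encode (B d : nat) (f : nat -> nat) : nat :=
  match d with O => 0 | S d' => encode B d' f + f d' * B ^ d' end%nat.

Definition digit (B a k : nat) : nat := ((a / B ^ k) mod B)%nat.

Lemma encode_lt (B d : nat) (f : nat -> nat) :
  (1 <= B)%nat -> (forall k, (k < d)%nat -> (f k < B)%nat) -> (encode B d f < B ^ d)%nat.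
Proof.
  intros HB; induction d as [|d IH]; intros Hf; simpl; [lia|].
  assert (encode B d f < B ^ d)%nat by (apply IH; auto with arith).
  assert (f d < B)%nat by auto with arith; nia.
Qed.

Lemma digit_encode (B d : nat) (f : nat -> nat) (k : nat) :
  (1 <= B)%nat -> (forall i, (i < d)%nat -> (f i < B)%nat) -> (k < d)%nat ->
  digit B (encode B d f) k = f k.
Proof.
  intros HB; unfold digit; induction d as [|d IH]; intros Hf Hk; [lia|simpl].
  assert (HBk : (B ^ k <> 0)%nat) by (apply Nat.pow_nonzero; lia).
  destruct (Nat.eq_dec k d) as [->|Hkd].
  - rewrite Nat.div_add, Nat.div_small, Nat.mod_small; auto with arith.
    + apply Hf; lia.
    + apply encode_lt; auto with arith.
  - replace (f d * B ^ d)%nat with ((f d * B ^ (d - S k) * B) * B ^ k)%nat.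
    2: { rewrite <- !Nat.mul_assoc, <- Nat.pow_succ_r', <- Nat.pow_add_r.
         do 2 f_equal; lia. }
    rewrite Nat.div_add, Nat.Div0.mod_add by exact HBk.
    apply IH; auto with arith; lia.
Qed.

(** Half-open, so that the children partition their parent and each point determines one path down
    the tree. *)
Definition cube (d : nat) (o : nat -> R) (s : R) (x : nat -> R) : Prop :=
  forall k, (k < d)%nat -> o k <= x k < o k + s.

Definition child (B : nat) (o : nat -> R) (s : R) (a : nat) : nat -> R :=
  fun k => o k + INR (digit B a k) * (s / INR B).

Definition child_index (d B : nat) (o : nat -> R) (s : R) (x : nat -> R) : nat :=
  encode B d (fun k => Z.to_nat (Int_part ((x k - o k) / (s / INR B)))).

Lemma child_index_spec (d B : nat) (o : nat -> R) (s : R) (x : nat -> R) :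
  (1 <= B)%nat -> 0 < s -> cube d o s x ->
  (child_index d B o s x < B ^ d)%nat /\
  cube d (child B o s (child_index d B o s x)) (s / INR B) x.
Proof.
  intros HB Hs Hx; unfold child_index; set (f := fun k => _).
  assert (HB' : 0 < INR B) by (apply lt_0_INR; lia).
  assert (Ht : 0 < s / INR B) by (apply Rdiv_lt_0_compat; assumption).
  assert (Hf : forall k, (k < d)%nat -> (f k < B)%nat /\
    INR (f k) * (s / INR B) <= x k - o k < INR (f k) * (s / INR B) + s / INR B).
  { intros k Hk; specialize (Hx k Hk); unfold f.
    set (y := (x k - o k) / (s / INR B)).
    assert (Hy : x k - o k = y * (s / INR B)) by (unfold y; field; lra).
    assert (Hsb : s = INR B * (s / INR B)) by (field; lra).
    set (t := s / INR B) in *; clearbody y.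
    assert (Hy0 : 0 <= y) by (apply Rmult_le_reg_r with t; lra).
    assert (HyB : y < INR B) by (apply Rmult_lt_reg_r with t; lra).
    destruct (base_Int_part y) as [H1 H2]; set (z := Int_part y) in *.
    assert (Hz : (0 <= z)%Z) by (assert (-1 < z)%Z by (apply lt_IZR; lra); lia).
    assert (HzB : (z < Z.of_nat B)%Z) by (apply lt_IZR; rewrite <- INR_IZR_INZ; lra).
    rewrite INR_IZR_INZ, Z2Nat.id by exact Hz.
    split; [lia|]; rewrite Hy; nra. }
  split; [apply encode_lt; [exact HB|intros k Hk; apply Hf, Hk]|].
  intros k Hk; unfold child; rewrite digit_encode; try assumption.
  - destruct (Hf k Hk); lra.
  - intros i Hi; apply Hf, Hi.
Qed.

Definition has_hole (d B : nat) (E : (nat -> R) -> Prop) (o : nat -> R) (s : R) : Prop :=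
  exists a, (a < B ^ d)%nat /\ forall y, cube d (child B o s a) (s / INR B) y -> ~ E y.

Fixpoint hole_at (d B : nat) (E : (nat -> R) -> Prop) (x : nat -> R) (l : nat)
    (o : nat -> R) (s : R) : Prop :=
  match l with
  | O => has_hole d B E o s
  | S l' => hole_at d B E x l' (child B o s (child_index d B o s x)) (s / INR B)
  end.

(* Cubes of the tree rooted at (o, s) that meet E and are reached right after leaving the j-th cube with a hole; the other words get side 0. *)
Fixpoint select (d B : nat) (E : (nat -> R) -> Prop) (w : list nat) (j : nat)
    (o : nat -> R) (s : R) : (nat -> R) * R :=
  if excluded_middle_informative (exists x, E x /\ cube d o s x) then
    match w, j with
    | nil, O => (o, s)
    | a :: w', S j' =>
        select d B E w' (if excluded_middle_informative (has_hole d B E o s) then j' else j)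
          (child B o s a) (s / INR B)
    | _, _ => (o, 0)
    end
  else (o, 0).

Lemma select_nonneg (d B : nat) (E : (nat -> R) -> Prop) (w : list nat) (j : nat)
    (o : nat -> R) (s : R) : 0 <= s -> 0 <= snd (select d B E w j o s).
Proof.
  revert j o s; induction w as [|a w IH]; intros j o s Hs; simpl;
    destruct (excluded_middle_informative _); simpl; try lra.
  - destruct j; simpl; lra.
  - destruct j; simpl; [lra|].
    apply IH; apply Rmult_le_pos; [exact Hs|].
    destruct B; [simpl; rewrite Rinv_0; lra|].
    left; apply Rinv_0_lt_compat, lt_0_INR; lia.
Qed.

Lemma select_empty (d B : nat) (E : (nat -> R) -> Prop) (w : list nat) (j : nat)
    (o : nat -> R) (s : R) :
  (forall y, cube d o s y -> ~ E y) -> select d B E w j o s = (o, 0).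
Proof.
  intros H; destruct w; simpl; destruct (excluded_middle_informative _) as [[y []]|];
    try reflexivity; destruct (H y); assumption.
Qed.

(** A cube with a hole passes on at most the fraction [1 - 1 / B ^ d] of its volume, and [j] such
    cubes are left on the way to a selected one. The induction on [N] goes through because the
    nonempty words split by first letter. *)
Lemma select_volume (d B : nat) (E : (nat -> R) -> Prop) (wd : nat -> list nat)
    (N j : nat) (o : nat -> R) (s : R) :
  (1 <= d)%nat -> (1 <= B)%nat -> 0 < s -> wd 0%nat = nil ->
  (forall a l, (a < B ^ d)%nat -> wd (S (a + B ^ d * l)) = a :: wd l) ->
  sumR N (fun l => snd (select d B E (wd l) j o s) ^ d) <= (1 - / INR (B ^ d)) ^ j * s ^ d.
Proof.
  intros Hd HB Hs H0 HS; set (M := (B ^ d)%nat) in *.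
  assert (HM : (1 <= M)%nat).
  { pose proof (Nat.pow_nonzero B d); unfold M; lia. }
  assert (HM1 : 1 <= INR M) by (apply (le_INR 1); exact HM).
  assert (Hth : 0 <= 1 - / INR M).
  { assert (/ INR M <= / 1) by (apply Rinv_le_contravar; lra); lra. }
  revert j o s Hs; induction N as [|N IH]; intros j o s Hs.
  { simpl; apply Rmult_le_pos; apply pow_le; lra. }
  (* Unselected words have side 0 and, as [d >= 1], contribute nothing. *)
  assert (Hp0 : 0 ^ d = 0) by (apply pow_i; lia).
  assert (Hpos : forall l, 0 <= snd (select d B E (wd l) j o s) ^ d).
  { intros l; apply pow_le, select_nonneg; lra. }
  apply Rle_trans with (sumR (1 + M * N) (fun l => snd (select d B E (wd l) j o s) ^ d)).
  { apply sumR_le_length; [exact Hpos|nia]. }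
  rewrite sumR_app, sumR_mul_length.
  rewrite (sumR_ext M _ (fun a => sumR N (fun l => snd (select d B E (a :: wd l) j o s) ^ d))).
  2: { intros a Ha; apply sumR_ext; intros l _; cbn [Nat.add]; rewrite HS by exact Ha; reflexivity. }
  cbn [sumR]; rewrite H0, Rplus_0_l.
  assert (Hsd : (s / INR B) ^ d = s ^ d * / INR M).
  { unfold Rdiv, M; rewrite Rpow_mult_distr, pow_inv, pow_INR; reflexivity. }
  assert (HsB : 0 < s / INR B) by (apply Rdiv_lt_0_compat; [exact Hs|apply lt_0_INR; lia]).
  assert (Hspos : 0 < s ^ d) by (apply pow_lt, Hs).
  simpl select.
  destruct (excluded_middle_informative (exists x, E x /\ cube d o s x)) as [_|_].
  2: { cbn [snd]; rewrite (sumR_ext M _ (fun _ => 0)).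
       - rewrite sumR_const, Hp0; assert (0 <= (1 - / INR M) ^ j * s ^ d)
           by (apply Rmult_le_pos; [apply pow_le|]; lra); lra.
       - intros a _; rewrite sumR_const, Hp0; ring. }
  destruct j as [|j].
  { cbn [snd]; rewrite (sumR_ext M _ (fun _ => 0)).
    - rewrite sumR_const; simpl; lra.
    - intros a _; rewrite sumR_const, Hp0; ring. }
  cbn [snd]; rewrite Hp0, Rplus_0_l.
  destruct (excluded_middle_informative (has_hole d B E o s)) as [[b [Hb Hhole]]|_].
  - set (c := (1 - / INR M) ^ j * (s ^ d * / INR M)).
    (* The child [b] that misses [E] contributes 0 and each of the other [M - 1] children at most
       [c]; the gain is the factor [(M - 1) / M]. *)
    apply Rle_trans with (sumR M (fun a => c * (if Nat.eq_dec a b then 0 else 1))).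
    + apply sumR_le; intros a _; destruct (Nat.eq_dec a b) as [->|_].
      * rewrite (sumR_ext N _ (fun _ => 0)); [rewrite sumR_const; lra|].
        intros l _; rewrite select_empty by exact Hhole; exact Hp0.
      * rewrite Rmult_1_r; unfold c; rewrite <- Hsd; apply IH, HsB.
    + assert (Hcount : forall M', sumR M' (fun a => if Nat.eq_dec a b then 0 else 1)
          = if (b <? M')%nat then INR M' - 1 else INR M').
      { induction M' as [|M' IHM]; [reflexivity|].
        cbn [sumR]; rewrite IHM, S_INR.
        destruct (Nat.eq_dec M' b), (Nat.ltb_spec b M'), (Nat.ltb_spec b (S M')); try lia; ring. }
      rewrite sumR_scal, Hcount; destruct (Nat.ltb_spec b M); [|fold M in Hb; lia].
      right; unfold c; simpl; field; lra.
  - eapply Rle_trans; [apply sumR_le; intros a _; apply IH, HsB|].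
    rewrite sumR_const, Hsd; right; field; lra.
Qed.

(** The path to [x] meets cubes with holes at arbitrarily deep levels, so it can be followed until
    [j] of them have been left. The outer induction counts the holes; the inner one, on [l],
    descends to the next hole. *)
Lemma select_covers (d B : nat) (E : (nat -> R) -> Prop) (x : nat -> R) (j : nat)
    (o : nat -> R) (s : R) :
  (1 <= B)%nat -> 0 < s -> E x -> cube d o s x ->
  (forall L, exists l, (L <= l)%nat /\ hole_at d B E x l o s) ->
  exists w, Forall (fun a => (a < B ^ d)%nat) w /\
    cube d (fst (select d B E w j o s)) (snd (select d B E w j o s)) x.
Proof.
  intros HB Hs HE; revert o s Hs.
  assert (HB' : 0 < INR B) by (apply lt_0_INR; lia).
  induction j as [|j IHj]; intros o s Hs Hx Hinf.
  { exists nil; split; [constructor|]; simpl.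
    destruct (excluded_middle_informative _) as [_|Hn]; [exact Hx|].
    destruct Hn; exists x; auto. }
  destruct (Hinf 0%nat) as (l & _ & Hl).
  revert o s Hs Hx Hinf Hl; induction l as [|l IHl]; intros o s Hs Hx Hinf Hl;
    destruct (child_index_spec d B o s x HB Hs Hx) as [Ha Hc];
    set (a := child_index d B o s x) in *;
    assert (HsB : 0 < s / INR B) by (apply Rdiv_lt_0_compat; assumption);
    assert (Hinf' : forall L, exists l, (L <= l)%nat /\ hole_at d B E x l (child B o s a) (s / INR B))
      by (intros L; destruct (Hinf (S L)) as ([|l'] & Hl' & Hh); [lia|];
          exists l'; split; [lia|exact Hh]);
    destruct (IHj _ _ HsB Hc Hinf') as (w & Hw & Hcov);
    (assert (Hmeet : exists y, E y /\ cube d o s y) by (exists x; auto));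
    destruct (excluded_middle_informative (has_hole d B E o s)) as [Hh|Hh].
  - exists (a :: w); split; [constructor; assumption|]; simpl.
    destruct (excluded_middle_informative _) as [_|]; [|contradiction].
    destruct (excluded_middle_informative _) as [_|]; [exact Hcov|contradiction].
  - contradiction.
  - exists (a :: w); split; [constructor; assumption|]; simpl.
    destruct (excluded_middle_informative _) as [_|]; [|contradiction].
    destruct (excluded_middle_informative _) as [_|]; [exact Hcov|contradiction].
  - destruct (IHl _ _ HsB Hc Hinf' Hl) as (w' & Hw' & Hcov').
    exists (a :: w'); split; [constructor; assumption|]; simpl.
    destruct (excluded_middle_informative _) as [_|]; [|contradiction].
    destruct (excluded_middle_informative _) as [|_]; [contradiction|exact Hcov'].
Qed.

(** For every [j], the cubes selected after [j] holes cover the set with total volume at most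
    [(1 - 1 / B ^ d) ^ j * s ^ d], which tends to 0. *)
Lemma null_set_of_holes (d B : nat) (E : (nat -> R) -> Prop) (o : nat -> R) (s : R) :
  (1 <= d)%nat -> (1 <= B)%nat -> 0 < s ->
  null_set d (fun x => E x /\ cube d o s x /\
    forall L, exists l, (L <= l)%nat /\ hole_at d B E x l o s).
Proof.
  intros Hd HB Hs eps Heps.
  assert (HM : (1 <= B ^ d)%nat) by (pose proof (Nat.pow_nonzero B d); lia).
  assert (HM1 : 1 <= INR (B ^ d)) by (apply (le_INR 1); exact HM).
  destruct (word_numeration (B ^ d) HM) as (wd & H0 & HS).
  assert (Hth : Rabs (1 - / INR (B ^ d)) < 1).
  { assert (0 < / INR (B ^ d)) by (apply Rinv_0_lt_compat; lra).
    assert (/ INR (B ^ d) <= / 1) by (apply Rinv_le_contravar; lra).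
    rewrite Rabs_pos_eq; lra. }
  assert (Hspos : 0 < s ^ d) by (apply pow_lt, Hs).
  destruct (pow_lt_1_zero _ Hth (eps / s ^ d)) as [j Hj]; [apply Rdiv_lt_0_compat; assumption|].
  specialize (Hj j (le_n j)).
  set (c := fun l => select d B E (wd l) j o s).
  exists (fun l => fst (c l)), (fun l k => fst (c l) k + snd (c l)); split.
  - intros x (HE & Hx & Hinf).
    destruct (select_covers d B E x j o s HB Hs HE Hx Hinf) as (w & Hw & Hcov).
    destruct (word_numeration_onto _ _ _ H0 HS Hw) as [l Hl].
    exists l; intros k Hk; unfold c; rewrite Hl; specialize (Hcov k Hk); lra.
  - intros N; rewrite sum_f_R0_sumR.
    rewrite (sumR_ext _ _ (fun l => snd (select d B E (wd l) j o s) ^ d)).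
    + eapply Rle_trans; [apply (select_volume d B E wd _ j o s); assumption|].
      pose proof (Rle_abs ((1 - / INR (B ^ d)) ^ j)).
      apply Rle_trans with (eps / s ^ d * s ^ d); [|right; field; lra].
      apply Rmult_le_compat_r; lra.
    + intros l _; unfold box_vol; rewrite <- prodR_const; apply prodR_ext; intros k _.
      fold (c l); rewrite Rmax_right; [ring|].
      assert (0 <= snd (c l)) by (apply select_nonneg; lra); lra.
Qed.

(** * Porous sets are null *)

(** Since [x] and [c] share a grid cell of side [s / B ^ l], the level-[l] cube around [x] contains
    [c]. Its child around [c] has side at most [r], so it stays within [r] of [c] and misses [E]. *)
Lemma hole_at_intro (d B : nat) (E : (nat -> R) -> Prop) (x c : nat -> R) (r : R)
    (l : nat) (o : nat -> R) (s : R) :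
  (1 <= B)%nat -> 0 < s -> cube d o s x ->
  (forall k, (k < d)%nat -> exists z : Z,
    o k + IZR z * (s / INR B ^ l) <= x k < o k + (IZR z + 1) * (s / INR B ^ l) /\
    o k + IZR z * (s / INR B ^ l) <= c k < o k + (IZR z + 1) * (s / INR B ^ l)) ->
  s / INR B ^ l / INR B <= r ->
  (forall y, (forall k, (k < d)%nat -> Rabs (y k - c k) <= r) -> ~ E y) ->
  hole_at d B E x l o s.
Proof.
  intros HB Hs Hx Hz Hr HE; revert o s Hs Hx Hz Hr.
  assert (HB' : 0 < INR B) by (apply lt_0_INR; lia).
  induction l as [|l IH]; intros o s Hs Hx Hz Hr; simpl.
  - simpl in Hz, Hr; rewrite Rdiv_1_r in Hz, Hr.
    assert (Hc : cube d o s c).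
    { intros k Hk; specialize (Hx k Hk); destruct (Hz k Hk) as (z & Hxz & Hcz).
      assert (z = 0)%Z as ->; [|lra].
      assert (-1 < z)%Z by (apply lt_IZR; nra).
      assert (z < 1)%Z by (apply lt_IZR; nra); lia. }
    destruct (child_index_spec d B o s c HB Hs Hc) as [Ha Hca].
    exists (child_index d B o s c); split; [exact Ha|].
    intros y Hy; apply HE; intros k Hk; specialize (Hy k Hk); specialize (Hca k Hk).
    apply Rabs_le; lra.
  - destruct (child_index_spec d B o s x HB Hs Hx) as [Ha Hxa].
    set (a := child_index d B o s x) in *.
    assert (HBl : 0 < INR B ^ l) by (apply pow_lt, HB').
    assert (Hside : s / INR B / INR B ^ l = s / INR B ^ S l) by (simpl; field; lra).
    apply IH; rewrite ?Hside; try assumption.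
    + apply Rdiv_lt_0_compat; assumption.
    + intros k Hk; destruct (Hz k Hk) as (z & Hxz & Hcz).
      (* Counted from the corner of the child, the cell index drops by the [digit B a k * B ^ l]
         cells that precede this corner. *)
      exists (z - Z.of_nat (digit B a k * B ^ l))%Z.
      assert (Hsh : forall t, child B o s a k + (IZR (z - Z.of_nat (digit B a k * B ^ l)) + t)
          * (s / INR B ^ S l) = o k + (IZR z + t) * (s / INR B ^ S l)).
      { intros t; unfold child; rewrite minus_IZR, <- INR_IZR_INZ, mult_INR, pow_INR.
        simpl; field; lra. }
      pose proof (Hsh 0) as Hsh0; rewrite !Rplus_0_r in Hsh0.
      rewrite Hsh0, Hsh; auto.
Qed.

Lemma infinite_pigeonhole (P : nat -> nat -> Prop) (T : nat) :
  (forall L, exists l u, (L <= l)%nat /\ (u < T)%nat /\ P l u) ->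
  exists u, forall L, exists l, (L <= l)%nat /\ P l u.
Proof.
  induction T as [|T IH]; intros H; [destruct (H 0%nat) as (l & u & _ & Hu & _); lia|].
  destruct (classic (forall L, exists l, (L <= l)%nat /\ P l T)) as [HT|HT]; [exists T; exact HT|].
  apply not_all_ex_not in HT; destruct HT as [L0 HL0].
  apply IH; intros L; destruct (H (L + L0)%nat) as (l & u & Hl & Hu & HP).
  exists l, u; split; [lia|split; [|exact HP]].
  enough (u <> T) by lia; intros ->; apply HL0; exists l; split; [lia|exact HP].
Qed.

(* Every point of s Z + 1/2 is at distance s / 2 from s Z, because 1 / s is an odd integer; so a short interval cannot meet both grids. *)
Lemma half_shifted_grid (s r x : R) (g : Z) :
  0 < r -> 4 * r < s -> 1 = (2 * IZR g + 1) * s ->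
  exists beta : nat, (beta < 2)%nat /\ exists z : Z,
    - (INR beta / 2) + IZR z * s <= x - r /\ x + r < - (INR beta / 2) + (IZR z + 1) * s.
Proof.
  intros Hr Hs Hg; set (z := Int_part ((x - r) / s)).
  destruct (base_Int_part ((x - r) / s)) as [H1 H2]; fold z in H1, H2.
  assert (Hy : x - r = (x - r) / s * s) by (field; lra).
  set (y := (x - r) / s) in *; clearbody y z.
  destruct (Rlt_le_dec (x + r) ((IZR z + 1) * s)) as [Hlt|Hle].
  - exists 0%nat; split; [lia|]; exists z; simpl; nra.
  (* Here the interval contains the grid point [(z + 1) * s]. Since [1 / 2 = g * s + s / 2], the
     cell of index [z + 1 + g] in the shifted grid is centred at that point. *)
  - exists 1%nat; split; [lia|]; exists (z + 1 + g)%Z.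
    rewrite !plus_IZR; simpl.
    assert (x - r < (IZR z + 1) * s) by nra.
    assert ((IZR z + 1 + IZR g) * s = (IZR z + 1) * s + 1 / 2 - s / 2) by lra.
    assert ((IZR z + 1 + IZR g + 1) * s = (IZR z + 1) * s + 1 / 2 + s / 2) by lra.
    split; lra.
Qed.

Lemma odd_pow (h i : nat) : exists g : Z, (INR (2 * h + 1)) ^ i = 2 * IZR g + 1.
Proof.
  induction i as [|i [g IH]]; [exists 0%Z; simpl; ring|].
  exists ((2 * Z.of_nat h + 1) * g + Z.of_nat h)%Z.
  rewrite <- tech_pow_Rmult, IH, plus_INR, mult_INR, plus_IZR, mult_IZR, plus_IZR, mult_IZR.
  rewrite <- !INR_IZR_INZ; simpl; ring.
Qed.

Lemma pow_bracket (q t : R) (n0 : nat) : 0 < q < 1 -> 0 < t < q ^ n0 ->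
  exists i, (n0 <= i)%nat /\ q ^ S i <= t < q ^ i.
Proof.
  intros Hq Ht; destruct (pow_lt_1_zero q) with (y := t) as [n Hn];
    [rewrite Rabs_pos_eq; lra|lra|].
  specialize (Hn (n0 + n)%nat ltac:(lia)).
  rewrite Rabs_pos_eq in Hn by (apply pow_le; lra); apply Rlt_le in Hn.
  induction n as [|n IH]; [rewrite Nat.add_0_r in Hn; lra|].
  destruct (Rlt_le_dec t (q ^ (n0 + n))) as [Hlt|Hle]; [|exact (IH Hle)].
  exists (n0 + n)%nat; rewrite Nat.add_succ_r in Hn; split; [lia|lra].
Qed.

(** Porosity in the supremum norm: the ratio [K] is the same at all points, while holes are asked
    only at some arbitrarily small scales. *)
Definition porous (d : nat) (K : R) (E : (nat -> R) -> Prop) : Prop :=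
  forall x, E x -> forall rho, 0 < rho -> exists (c : nat -> R) (r : R),
    0 < r < rho /\ (forall k, (k < d)%nat -> Rabs (x k - c k) <= r) /\
    forall y, (forall k, (k < d)%nat -> Rabs (y k - c k) <= r / K) -> ~ E y.

(** Finitely many trees suffice: each coordinate of the root has two possible shifts, and its side
    two possible values. By pigeonhole, the holes near a given point fall into one of these trees at
    arbitrarily deep levels. *)
Lemma null_set_porous (d : nat) (K : R) (E : (nat -> R) -> Prop) :
  (1 <= d)%nat -> 1 <= K -> (forall x, E x -> in_unit_cube d x) -> porous d K E ->
  null_set d E.
Proof.
  intros Hd HK Hcube Hpor.
  destruct (INR_unbounded (4 * K)) as [h Hh].
  (* Odd for the sake of the half-shifted grids, and at least [4 * K] so that a cell of side
     [q ^ i / b ^ 2] around [c] fits into the hole. *)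
  set (b := (2 * h + 1)%nat).
  assert (Hb : 4 * K <= INR b) by (unfold b; rewrite plus_INR, mult_INR; simpl; lra).
  assert (Hb0 : 0 < INR b) by lra.
  set (q := / INR b).
  assert (Hq : 0 < q < 1).
  { split; [apply Rinv_0_lt_compat, Hb0|]; unfold q; rewrite <- Rinv_1.
    apply Rinv_lt_contravar; lra. }
  (* The [d + 1] binary digits of [u] describe a root: the first [d] say which coordinates are
     shifted by [- 1 / 2], the last one chooses the side [b] or [b ^ 2]. The tree has base [b * b],
     so the two sides together realise every scale [q ^ i]. *)
  set (o := fun u k => - (INR (digit 2 u k) / 2)).
  set (s := fun u => INR b ^ S (digit 2 u d)).
  assert (Hs3 : forall u, 3 <= s u).
  { intros u; unfold s; rewrite <- tech_pow_Rmult.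
    assert (1 <= INR b ^ digit 2 u d) by (apply pow_R1_Rle; lra); nra. }
  assert (Hroot : forall u x, E x -> cube d (o u) (s u) x).
  { intros u x Hx k Hk; specialize (Hcube x Hx k Hk); specialize (Hs3 u); unfold o.
    assert (digit 2 u k < 2)%nat as Hdig by (apply Nat.mod_upper_bound; lia).
    assert (0 <= INR (digit 2 u k) <= 1).
    { split; [apply pos_INR|apply (le_INR _ 1); lia]. }
    lra. }
  apply lebesgue_outer_le_subset with (fun x => exists u, E x /\ cube d (o u) (s u) x /\
    forall L, exists l, (L <= l)%nat /\ hole_at d (b * b) E x l (o u) (s u)).
  2: { apply null_set_countable_union; intros u; apply null_set_of_holes; [exact Hd|lia|].
       specialize (Hs3 u); lra. }
  intros x Hx.
  enough (exists u, forall L, exists l, (L <= l)%nat /\ hole_at d (b * b) E x l (o u) (s u))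
    as [u Hu] by (exists u; auto).
  apply infinite_pigeonhole with (2 ^ S d)%nat; intros L.
  (* With [4 * r < q ^ (2 * L)] the scale satisfies [2 * L <= i], which puts the level [l] beyond
     [L]. *)
  destruct (Hpor x Hx (q ^ (2 * L) / 4)) as (c & r & Hr & Hxc & Hhole).
  { apply Rdiv_lt_0_compat; [apply pow_lt|]; lra. }
  destruct (pow_bracket q (4 * r) (2 * L) Hq) as (i & HLi & Hi1 & Hi2); [lra|].
  destruct (odd_pow h i) as [g Hg]; fold b in Hg.
  assert (Hqi : 1 = (2 * IZR g + 1) * q ^ i).
  { rewrite <- Hg; unfold q; rewrite pow_inv; field; apply pow_nonzero; lra. }
  destruct (functional_choice (fun k beta => (beta < 2)%nat /\ exists z : Z,
      - (INR beta / 2) + IZR z * q ^ i <= x k - r /\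
      x k + r < - (INR beta / 2) + (IZR z + 1) * q ^ i)) as [f Hf].
  { intros k; apply half_shifted_grid with g; lra. }
  (* This makes [i + S e] even, so the root of side [b ^ S e] has cells of side [q ^ i] at level
     [l]. *)
  set (e := (1 - i mod 2)%nat).
  set (f' := fun k => if (k <? d)%nat then f k else e).
  assert (Hf' : forall k, (k < S d)%nat -> (f' k < 2)%nat).
  { intros k _; unfold f', e; destruct (k <? d)%nat; [apply Hf|lia]. }
  set (u := encode 2 (S d) f'); set (l := S (i / 2)).
  assert (Hie : (2 * l = i + S e)%nat).
  { unfold l, e; pose proof (Nat.div_mod_eq i 2); pose proof (Nat.mod_upper_bound i 2); lia. }
  assert (Hsu : s u = INR b ^ S e).
  { unfold s, u; rewrite digit_encode by (assumption || lia); unfold f'.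
    rewrite Nat.ltb_irrefl; reflexivity. }
  assert (Hside : s u / INR (b * b) ^ l = q ^ i).
  { rewrite Hsu, mult_INR.
    replace (INR b * INR b) with (INR b ^ 2) by ring.
    rewrite <- pow_mult, Hie, pow_add; unfold q; rewrite pow_inv; field.
    split; apply pow_nonzero; lra. }
  exists l, u; split; [lia|split; [apply encode_lt; [lia|exact Hf']|]].
  apply hole_at_intro with c (r / K); rewrite ?Hside.
  - unfold b; nia.
  - specialize (Hs3 u); lra.
  - apply Hroot, Hx.
  - intros k Hk; destruct (Hf k) as (_ & z & Hz1 & Hz2); exists z.
    assert (Hok : o u k = - (INR (f k) / 2)).
    { unfold o, u; rewrite digit_encode by (assumption || lia); unfold f'.
      destruct (Nat.ltb_spec k d); [reflexivity|lia]. }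
    rewrite Hok; specialize (Hxc k Hk).
    pose proof (Rle_abs (x k - c k)); pose proof (Rle_abs (- (x k - c k))).
    rewrite Rabs_Ropp in *; split; lra.
  - rewrite mult_INR; replace (q ^ i / (INR b * INR b)) with (q ^ S i * q)
      by (unfold q; simpl; field; lra).
    apply Rle_trans with (4 * r * q); [apply Rmult_le_compat_r; lra|].
    unfold q; apply Rmult_le_reg_r with (INR b * K); [nra|].
    replace (4 * r * / INR b * (INR b * K)) with (4 * r * K) by (field; lra).
    replace (r / K * (INR b * K)) with (r * INR b) by (field; lra); nra.
  - exact Hhole.
Qed.

(** * Coprime integers in long intervals *)

Lemma prime_divisor_exists (d : Z) : (1 < d)%Z -> exists p, prime p /\ (p | d)%Z.
Proof.
  intros Hd; assert (H0 : (0 <= d)%Z) by lia; revert Hd; pattern d.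
  apply Z_lt_induction; [clear d H0|exact H0].
  intros d IH Hd; destruct (prime_dec d) as [Hp|Hp]; [exists d; split; [exact Hp|apply Z.divide_refl]|].
  destruct (not_prime_divide d Hd Hp) as (a & Ha & Had).
  destruct (IH a ltac:(lia) ltac:(lia)) as (p & Hp' & Hpa).
  exists p; split; [exact Hp'|apply Z.divide_trans with a; assumption].
Qed.

Lemma prime_part (p d : Z) : prime p -> (0 < d)%Z ->
  exists s e, (0 < s)%Z /\ (0 <= e)%Z /\ d = (s * p ^ e)%Z /\ ~ (p | s)%Z.
Proof.
  intros Hp Hd; assert (H0 : (0 <= d)%Z) by lia; revert Hd; pattern d.
  apply Z_lt_induction; [clear d H0|exact H0].
  intros d IH Hd; pose proof (prime_ge_2 p Hp).
  destruct (Zdivide_dec p d) as [[c Hc]|Hn].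
  - destruct (IH c ltac:(nia) ltac:(nia)) as (s & e & Hs & He & -> & Hps).
    exists s, (e + 1)%Z; repeat split; try lia; try assumption.
    rewrite Z.pow_add_r, Z.pow_1_r by lia; rewrite Hc; ring.
  - exists d, 0%Z; repeat split; try lia; assumption.
Qed.

Lemma divide_fact (K : nat) (t : Z) : (0 < t <= Z.of_nat K)%Z -> (t | Z.of_nat (fact K))%Z.
Proof.
  induction K as [|K IH]; intros Ht; [simpl in Ht; lia|].
  change (fact (S K)) with (S K * fact K)%nat; rewrite Nat2Z.inj_mul.
  destruct (Z.eq_dec t (Z.of_nat (S K))) as [->|Hne]; [apply Z.divide_factor_l|].
  apply Z.divide_mul_r, IH; lia.
Qed.

(** If all prime powers exactly dividing [d] are at most [K], they divide [K!] and, being pairwise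
    coprime, so does their product [d]. The induction strips off one prime at a time. *)
Lemma large_prime_power (K : nat) (d : Z) : (0 < d)%Z ->
  (d | Z.of_nat (fact K))%Z \/
  exists s p e, prime p /\ (0 < s)%Z /\ (0 <= e)%Z /\ d = (s * p ^ e)%Z /\
    ~ (p | s)%Z /\ (Z.of_nat K < p ^ e)%Z.
Proof.
  intros Hd; assert (H0 : (0 <= d)%Z) by lia; revert Hd; pattern d.
  apply Z_lt_induction; [clear d H0|exact H0].
  intros d IH Hd.
  destruct (Z.eq_dec d 1) as [->|Hd1]; [left; apply Z.divide_1_l|].
  destruct (prime_divisor_exists d) as (p & Hp & Hpd); [lia|].
  destruct (prime_part p d Hp Hd) as (s & e & Hs & He & Hdse & Hps).
  pose proof (prime_ge_2 p Hp).
  assert (Hpe : (0 < p ^ e)%Z) by (apply Z.pow_pos_nonneg; lia).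
  destruct (Z_lt_le_dec (Z.of_nat K) (p ^ e)) as [Hbig|Hsmall];
    [right; exists s, p, e; auto 7|].
  assert (Hsd : (s < d)%Z).
  { destruct (Z.eq_dec e 0) as [->|He0].
    - rewrite Z.pow_0_r, Z.mul_1_r in Hdse; subst; contradiction.
    - assert (1 < p ^ e)%Z by (apply Z.pow_gt_1; lia); nia. }
  assert (Hrel : rel_prime s (p ^ e)).
  { apply rel_prime_Zpower_r; [exact He|].
    apply rel_prime_sym, prime_rel_prime; assumption. }
  destruct (IH s ltac:(lia) Hs) as [Hdiv|(s' & p' & e' & Hp' & Hs' & He' & Hse & Hps' & Hbig)].
  - left; rewrite Hdse; destruct Hdiv as [c Hc]; rewrite Hc, Z.mul_comm.
    apply Z.mul_divide_mono_r, Gauss with s; [|apply rel_prime_sym; exact Hrel].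
    rewrite Z.mul_comm, <- Hc; apply divide_fact; lia.
  - right; exists (s' * p ^ e)%Z, p', e'.
    split; [exact Hp'|split; [lia|split; [exact He'|split; [rewrite Hdse, Hse at 1; ring|]]]].
    split; [|exact Hbig].
    intros Hdiv; destruct (prime_mult p' Hp' _ _ Hdiv) as [Hd'|Hd']; [contradiction|].
    (* A prime dividing [p ^ e] equals [p], which does not divide [s]; but [p'] divides [s], its
       exponent being positive because [1 <= K < p' ^ e']. *)
    assert (p' = p) as -> by (apply prime_power_prime with e; assumption).
    apply Hps; rewrite Hse; apply Z.divide_mul_r.
    replace e' with (1 + (e' - 1))%Z by ring.
    assert (e' <> 0)%Z by (intros ->; lia); rewrite Z.pow_add_r, Z.pow_1_r by lia.
    apply Z.divide_factor_l.
Qed.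

Lemma shift_into (y s : R) : 0 < s -> exists z : Z, 0 <= y + s * IZR z < s.
Proof.
  intros Hs; exists (- Int_part (y / s))%Z; rewrite opp_IZR.
  destruct (base_Int_part (y / s)) as [H1 H2].
  assert (Hy : y = y / s * s) by (field; lra).
  set (t := y / s) in *; clearbody t; nra.
Qed.

Lemma gcd_1_mul_add (s z : Z) : Z.gcd (1 + s * z) s = 1%Z.
Proof. rewrite Z.gcd_comm, (Z.mul_comm s), Z.gcd_add_mult_diag_r; apply Z.gcd_1_r. Qed.

(* Once d does not divide K!, some prime power p ^ e > K divides d exactly; with d = s p ^ e, one of two consecutive integers congruent to 1 modulo s is not divisible by p, hence coprime to d. *)
Lemma coprime_near (eps : R) : 0 < eps -> exists C, 0 < C /\
  forall (d : Z) (y : R), (0 < d)%Z ->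
    exists p : Z, Z.gcd p d = 1%Z /\ Rabs (y + IZR p) <= eps * IZR d + C.
Proof.
  (* With this [K], a factor [p ^ e > K] gives [2 * s <= eps * d], which is room for two consecutive
     candidates. *)
  intros Heps; destruct (INR_unbounded (2 / eps)) as [K HK].
  assert (HK' : 2 < eps * INR K).
  { apply Rmult_lt_compat_l with (r := eps) in HK; [|exact Heps].
    replace (eps * (2 / eps)) with 2 in HK by (field; lra); exact HK. }
  (* The constant absorbs the [d] that divide [K!]: they are at most [K!], and some integer
     congruent to 1 modulo [d] lies within [d] of [- y]. *)
  exists (INR (fact K)).
  assert (HC : 0 < INR (fact K)) by apply INR_fact_lt_0.
  split; [exact HC|]; intros d y Hd.
  assert (Hd' : 0 < IZR d) by (apply (IZR_lt 0); exact Hd).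
  destruct (large_prime_power K d Hd) as [Hdiv|(s & p & e & Hp & Hs & He & Hdse & Hps & Hbig)].
  - destruct (shift_into (y + 1) (IZR d) Hd') as [z Hz].
    exists (1 + d * z)%Z; split; [apply gcd_1_mul_add|].
    assert (IZR d <= INR (fact K)).
    { rewrite INR_IZR_INZ; apply IZR_le, Z.divide_pos_le; [|exact Hdiv].
      pose proof (lt_O_fact K); lia. }
    rewrite plus_IZR, mult_IZR, Rabs_pos_eq by lra; nra.
  - assert (Hs' : 0 < IZR s) by (apply (IZR_lt 0); exact Hs).
    destruct (shift_into (y + 1) (IZR s) Hs') as [z Hz].
    assert (Hsd : 2 * IZR s <= eps * IZR d).
    { assert (HsK : INR K * IZR s <= IZR d).
      { rewrite INR_IZR_INZ, <- mult_IZR; apply IZR_le; nia. }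
      nra. }
    assert (Hgcd : forall t, ~ (p | 1 + s * t)%Z -> Z.gcd (1 + s * t) d = 1%Z).
    { intros t Ht; rewrite Hdse; apply Zgcd_1_rel_prime, rel_prime_mult.
      - apply Zgcd_1_rel_prime, gcd_1_mul_add.
      - apply rel_prime_Zpower_r; [exact He|].
        apply rel_prime_sym, prime_rel_prime; assumption. }
    destruct (Zdivide_dec p (1 + s * z)) as [Hpz|Hpz].
    + exists (1 + s * (z + 1))%Z; split.
      * apply Hgcd; intros Hpz'; apply Hps.
        replace s with ((1 + s * (z + 1)) - (1 + s * z))%Z by ring.
        apply Z.divide_sub_r; assumption.
      * rewrite plus_IZR, mult_IZR, plus_IZR, Rabs_pos_eq by lra; lra.
    + exists (1 + s * z)%Z; split; [apply Hgcd, Hpz|].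
      rewrite plus_IZR, mult_IZR, Rabs_pos_eq by lra; lra.
Qed.

(** * Solutions of bounded height *)

Fixpoint height (q : list Z) : Z :=
  match q with nil => 0%Z | z :: q' => Z.max (Z.abs z) (height q') end.

Lemma height_nonneg (q : list Z) : (0 <= height q)%Z.
Proof. induction q; simpl; lia. Qed.

Lemma height_nth (q : list Z) (i : nat) : (Z.abs (nth i q 0%Z) <= height q)%Z.
Proof.
  revert i; induction q as [|z q IH]; intros [|i]; simpl; try lia.
  specialize (IH i); lia.
Qed.

Lemma height_le (q : list Z) (H : Z) :
  (0 <= H)%Z -> (forall i, (i < length q)%nat -> (Z.abs (nth i q 0%Z) <= H)%Z) ->
  (height q <= H)%Z.
Proof.
  intros HH; induction q as [|z q IH]; intros Hq; simpl; [exact HH|].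
  apply Z.max_lub; [apply (Hq 0%nat); simpl; lia|].
  apply IH; intros i Hi; apply (Hq (S i)); simpl; lia.
Qed.

Lemma height_attained (q : list Z) : Exists (fun z => z <> 0%Z) q ->
  (0 < height q)%Z /\
  exists i, (i < length q)%nat /\ height q = Z.abs (nth i q 0%Z).
Proof.
  intros Hq; assert (H0 : (0 < height q)%Z).
  { induction Hq as [z q Hz|z q _ IH]; simpl; [|lia].
    pose proof (height_nonneg q); lia. }
  split; [exact H0|]; clear Hq; induction q as [|z q IH]; simpl in *; [lia|].
  destruct (Z_le_gt_dec (height q) (Z.abs z)) as [Hle|Hgt].
  - exists 0%nat; simpl; lia.
  - destruct IH as (i & Hi & Hh); [lia|]; exists (S i); simpl; split; [lia|]; rewrite <- Hh; lia.
Qed.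

(** A finite list to be avoided: [infinitely_many] applied to it yields solutions of larger
    height. *)
Fixpoint lists_of_height (n : nat) (H : Z) : list (list Z) :=
  match n with
  | O => nil :: nil
  | S n' =>
      flat_map (fun i => map (cons (Z.of_nat i - H)%Z) (lists_of_height n' H))
        (seq 0 (Z.to_nat (2 * H + 1)))
  end.

Lemma in_lists_of_height (n : nat) (H : Z) (q : list Z) :
  length q = n -> (height q <= H)%Z -> In q (lists_of_height n H).
Proof.
  intros <-; induction q as [|z q IH]; intros Hq; [left; reflexivity|].
  cbn [height] in Hq; pose proof (height_nonneg q); cbn [length lists_of_height].
  apply in_flat_map; exists (Z.to_nat (z + H)); split; [apply in_seq; lia|].
  apply in_map_iff; exists q; split; [f_equal; lia|apply IH; lia].
Qed.

Lemma gcd_list_divide (q : list Z) (i : nat) : (gcd_list q | nth i q 0%Z)%Z.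
Proof.
  revert i; induction q as [|z q IH]; intros i; [destruct i; apply Z.divide_0_r|].
  destruct i as [|i]; simpl; [apply Z.gcd_divide_l|].
  apply Z.divide_trans with (gcd_list q); [apply Z.gcd_divide_r|apply IH].
Qed.

Lemma gcd_list_app (p q : list Z) : gcd_list (p ++ q) = Z.gcd (gcd_list p) (gcd_list q).
Proof.
  induction p as [|z p IH]; simpl.
  - destruct q; [reflexivity|]; simpl; symmetry; apply Z.abs_eq, Z.gcd_nonneg.
  - fold (gcd_list (p ++ q)); rewrite IH, Z.gcd_assoc; reflexivity.
Qed.

(** The gcd divides a nonzero entry of largest absolute value. This turns the error
    [eps * gcd_list q] coming from [coprime_near] into [eps * height q]. *)
Lemma gcd_list_bounds (q : list Z) : Exists (fun z => z <> 0%Z) q ->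
  (0 < gcd_list q <= height q)%Z.
Proof.
  intros Hq; destruct (height_attained q Hq) as (H0 & i & Hi & Hh).
  pose proof (gcd_list_divide q i) as Hd.
  assert (Hnn : (0 <= gcd_list q)%Z) by (destruct q; [simpl; lia|apply Z.gcd_nonneg]).
  assert (Hne : gcd_list q <> 0%Z).
  { intros He; rewrite He in Hd; apply Z.divide_0_l in Hd; lia. }
  split; [lia|]; rewrite Hh; apply Z.divide_pos_le; [lia|].
  apply Z.divide_abs_r, Hd.
Qed.

(** The condition for [DPrime] is the strongest of the three; for [Prime] a single entry of [p] is
    enough, whence [1 <= length p]. *)
Lemma coprime_cond_intro (v : variant) (p q : list Z) :
  (1 <= length p)%nat ->
  (forall j, (j < length p)%nat -> Z.gcd (nth j p 0%Z) (gcd_list q) = 1%Z) ->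
  coprime_cond v p q.
Proof.
  intros Hp H; destruct v; simpl; [exact I| |exact H].
  destruct p as [|z p]; simpl in Hp; [lia|].
  specialize (H 0%nat Hp); rewrite gcd_list_app; simpl in *.
  rewrite (Z.gcd_comm z), <- Z.gcd_assoc, H; apply Z.gcd_1_r.
Qed.

Lemma solution_weaken (v : variant) (n m : nat) (Phi Psi : list Z -> R) (x : nat -> R)
    (pq : list Z * list Z) :
  (forall q, length q = n -> Phi q <= Psi q) ->
  solution v n m Phi x pq -> solution v n m Psi x pq.
Proof.
  destruct pq as [p q]; intros H (Hp & Hq & Hnz & Hlt & Hco).
  repeat split; try assumption.
  intros j Hj; specialize (Hlt j Hj); specialize (H q Hq); lra.
Qed.

Lemma infinitely_many_solutions_of_large_Psi (v : variant) (n m : nat) (Psi : list Z -> R)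
    (x : nat -> R) (eta : R) (k : nat) :
  (1 <= m)%nat -> (1 <= k)%nat -> 0 < eta ->
  (forall L, exists q, ~ In q L /\ length q = n /\ Exists (fun z => z <> 0%Z) q /\
    eta * IZR (height q) <= Psi q) ->
  infinitely_many (solution v n m (fun q => Psi q / INR k) x).
Proof.
  intros Hm Hk Heta Hlarge L.
  assert (Hk' : 0 < INR k) by (apply lt_0_INR; lia).
  (* Half of the allowance [eta * height q / k] covers the term [eps * gcd_list q], the other half
     covers [C] once [height q > C / eps]. *)
  set (eps := eta / (2 * INR k)).
  assert (Heps : 0 < eps) by (apply Rdiv_lt_0_compat; lra).
  destruct (coprime_near eps Heps) as (C & HC & Hco).
  destruct (INR_unbounded (C / eps)) as [H HH].
  (* Avoiding the second components of [L] makes the pair new; avoiding small heights makes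
     [height q] exceed [C / eps]. *)
  destruct (Hlarge (map snd L ++ lists_of_height n (Z.of_nat H)))
    as (q & HqL & Hqn & Hqnz & HqPsi).
  assert (HqH : (Z.of_nat H < height q)%Z).
  { apply Z.nle_gt; intros Hle; apply HqL, in_or_app; right.
    apply in_lists_of_height; assumption. }
  destruct (gcd_list_bounds q Hqnz) as [Hg0 Hgh].
  destruct (functional_choice (fun j p => Z.gcd p (gcd_list q) = 1%Z /\
      Rabs (qX n m q x j + IZR p) <= eps * IZR (gcd_list q) + C)) as [p Hp].
  { intros j; apply Hco, Hg0. }
  assert (Hlen : length (map p (seq 0 m)) = m) by (rewrite length_map, length_seq; reflexivity).
  assert (Hnth : forall j, (j < m)%nat -> nth j (map p (seq 0 m)) 0%Z = p j).
  { intros j Hj; rewrite nth_indep with (d' := p 0%nat) by (rewrite Hlen; exact Hj).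
    rewrite map_nth, seq_nth by exact Hj; reflexivity. }
  exists (map p (seq 0 m), q); split.
  { intros Hin; apply HqL, in_or_app; left; apply (in_map snd) in Hin; exact Hin. }
  split; [exact Hlen|split; [exact Hqn|split; [exact Hqnz|split]]].
  - intros j Hj; rewrite Hnth by exact Hj; destruct (Hp j) as [_ Hpj].
    eapply Rle_lt_trans; [exact Hpj|].
    apply Rlt_le_trans with (eta * IZR (height q) / INR k).
    2: { apply Rmult_le_compat_r; [left; apply Rinv_0_lt_compat|]; assumption. }
    replace (eta * IZR (height q) / INR k) with (eps * IZR (height q) + eps * IZR (height q))
      by (unfold eps; field; lra).
    apply Rplus_le_lt_compat.
    + apply Rmult_le_compat_l; [lra|apply IZR_le; exact Hgh].
    + apply IZR_lt in HqH; rewrite <- INR_IZR_INZ in HqH.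
      replace C with (eps * (C / eps)) by (field; lra).
      apply Rmult_lt_compat_l; lra.
  - apply coprime_cond_intro; rewrite Hlen; [exact Hm|].
    intros j Hj; rewrite Hnth by exact Hj; apply Hp.
Qed.

(** * The exceptional sets and their porosity *)

Definition exceptional (v : variant) (n m : nat) (Psi : list Z -> R) (N : nat)
    (x : nat -> R) : Prop :=
  Aset v n m Psi x /\
  forall p q, solution v n m (fun q => Psi q / INR N) x (p, q) ->
    (height p <= Z.of_nat N)%Z /\ (height q <= Z.of_nat N)%Z.

Lemma exceptional_not_infinitely_many (v : variant) (n m : nat) (Psi : list Z -> R)
    (N : nat) (x : nat -> R) :
  exceptional v n m Psi N x ->
  ~ infinitely_many (solution v n m (fun q => Psi q / INR N) x).
Proof.
  intros [_ Hh] Hinf.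
  destruct (Hinf (list_prod (lists_of_height m (Z.of_nat N)) (lists_of_height n (Z.of_nat N))))
    as [[p q] [Hin Hs]].
  apply Hin; destruct (Hh p q Hs); destruct Hs as (Hp & Hq & _).
  apply in_prod; apply in_lists_of_height; assumption.
Qed.

Lemma not_Wset_exceptional (v : variant) (n m : nat) (Psi : list Z -> R) (x : nat -> R) :
  (forall q, length q = n -> 0 < Psi q) ->
  Aset v n m Psi x -> ~ Wset v n m Psi x -> exists i, exceptional v n m Psi (S i) x.
Proof.
  intros HPsi HA HW.
  apply not_all_ex_not in HW; destruct HW as [k HW].
  apply imply_to_and in HW; destruct HW as [Hk HW].
  assert (Hninf : ~ infinitely_many (solution v n m (fun q => Psi q / INR k) x)).
  { intros Hinf; apply HW; split; [apply HA|exact Hinf]. }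
  apply not_all_ex_not in Hninf; destruct Hninf as [L HL].
  assert (Hbound : exists H, forall p q, In (p, q) L -> (height p <= H)%Z /\ (height q <= H)%Z).
  { clear HL; induction L as [|[p q] L [H IH]]; [exists 0%Z; intros p q []|].
    exists (Z.max H (Z.max (height p) (height q))); intros p' q' [Heq|Hin].
    - inversion Heq; lia.
    - specialize (IH p' q' Hin); lia. }
  (* The index exceeds [k], so that its solutions also solve the inequality for [Psi / k] and lie in
     [L], and it exceeds the heights occurring in [L]. *)
  destruct Hbound as [H HH]; exists (k + Z.to_nat H)%nat; split; [exact HA|].
  intros p q Hs.
  enough (Hin : In (p, q) L) by (specialize (HH p q Hin); lia).
  apply NNPP; intros Hin; apply HL; exists (p, q); split; [exact Hin|].
  revert Hs; apply solution_weaken; intros q' Hq'; specialize (HPsi q' Hq').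
  apply Rmult_le_compat_l; [lra|].
  apply Rinv_le_contravar; [apply lt_0_INR; lia|apply le_INR; lia].
Qed.

(** For fixed [q] the inequality bounds every [|p_j|] by [|(q X)_j| + Psi q]. Hence infinitely many
    solutions involve [q] outside any given finite list. *)
Lemma solution_height_bound (v : variant) (n m : nat) (Psi : list Z -> R) (x : nat -> R)
    (L : list (list Z)) :
  exists H, forall p q, In q L -> solution v n m Psi x (p, q) -> (height p <= H)%Z.
Proof.
  induction L as [|q L [H IH]]; [exists 0%Z; intros p q []|].
  set (s := sumR m (fun j => Rabs (qX n m q x j)) + Rabs (Psi q)).
  assert (Hs : 0 <= s).
  { apply Rplus_le_le_0_compat; [|apply Rabs_pos].
    rewrite <- (Rmult_0_r (INR m)), <- sumR_const; apply sumR_le; intros; apply Rabs_pos. }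
  assert (Hup : (0 <= up s)%Z) by (apply le_IZR; destruct (archimed s); lra).
  exists (Z.max H (up s)); intros p q' [<-|Hin] Hsol; [|specialize (IH p q' Hin Hsol); lia].
  transitivity (up s); [|lia].
  destruct Hsol as (Hp & _ & _ & Hlt & _).
  apply height_le; [exact Hup|]; intros j Hj; rewrite Hp in Hj; specialize (Hlt j Hj).
  apply le_IZR; rewrite abs_IZR; destruct (archimed s) as [Hs1 _].
  assert (Hj' : Rabs (qX n m q x j) <= sumR m (fun j => Rabs (qX n m q x j))).
  { clear - Hj; set (f := fun j => Rabs (qX n m q x j)); change (f j <= sumR m f).
    assert (Hf : forall i, 0 <= f i) by (intros; apply Rabs_pos).
    apply Rle_trans with (sumR (S j) f); [|apply sumR_le_length; [exact Hf|lia]].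
    simpl; pose proof (sumR_le_length 0 j f Hf (Nat.le_0_l j)) as H; simpl in H; lra. }
  pose proof (Rabs_triang (qX n m q x j + IZR (nth j p 0%Z)) (- qX n m q x j)) as Ht.
  rewrite Rabs_Ropp in Ht.
  replace (qX n m q x j + IZR (nth j p 0%Z) + - qX n m q x j) with (IZR (nth j p 0%Z)) in Ht by ring.
  pose proof (Rle_abs (Psi q)); unfold s in *; lra.
Qed.

Lemma sumR_single (n i : nat) (t : R) : (i < n)%nat ->
  sumR n (fun i' => if Nat.eq_dec i' i then t else 0) = t.
Proof.
  assert (H : forall n', sumR n' (fun i' => if Nat.eq_dec i' i then t else 0)
    = if (i <? n')%nat then t else 0).
  { induction n' as [|n' IH]; [reflexivity|]; cbn [sumR]; rewrite IH.
    destruct (Nat.eq_dec n' i), (Nat.ltb_spec i n'), (Nat.ltb_spec i (S n')); try lia; ring. }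
  intros Hi; rewrite H; destruct (Nat.ltb_spec i n); [reflexivity|lia].
Qed.

(* Moving x along the row of X at which |q_i| is maximal reaches the affine subspace q Y + p = 0 within distance Psi(q) / |q|, and a proportional neighbourhood of that subspace solves the inequality for Psi / N. *)
Lemma porous_exceptional (v : variant) (n m : nat) (Psi : list Z -> R) (N : nat) :
  (1 <= n)%nat -> (1 <= N)%nat -> (forall q, length q = n -> 0 < Psi q) ->
  (forall eta, 0 < eta -> exists L, forall q, length q = n ->
    Exists (fun z => z <> 0%Z) q -> ~ In q L -> Psi q < eta * IZR (height q)) ->
  porous (n * m) (2 * INR n * INR N) (exceptional v n m Psi N).
Proof.
  intros Hn HN HPsi Hsmall x [[_ Hinf] _] rho Hrho.
  assert (Hn' : 0 < INR n) by (apply lt_0_INR; lia).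
  assert (HN' : 0 < INR N) by (apply lt_0_INR; lia).
  (* Outside [L] the radius [Psi q / height q] is below [rho]. *)
  destruct (Hsmall rho Hrho) as [L HL].
  destruct (solution_height_bound v n m Psi x L) as [H HH].
  set (hN := Z.of_nat N).
  (* Two families are avoided: the solutions with [q] in [L], whose [p] have height at most [H], and
     the pairs with both heights at most [N]. *)
  destruct (Hinf (list_prod (lists_of_height m H) L ++
      list_prod (lists_of_height m hN) (lists_of_height n hN))) as [[p q] [Hnin Hsol]].
  assert (Hbig : ~ ((height p <= hN)%Z /\ (height q <= hN)%Z)).
  { intros [Hpb Hqb]; apply Hnin, in_or_app; right; destruct Hsol as (Hp & Hq & _).
    apply in_prod; apply in_lists_of_height; assumption. }
  assert (HqL : ~ In q L).
  { intros HqL; apply Hnin, in_or_app; left; pose proof (HH p q HqL Hsol).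
    destruct Hsol as (Hp & _); apply in_prod; [apply in_lists_of_height|]; assumption. }
  destruct Hsol as (Hp & Hq & Hqnz & Hlt & Hco).
  specialize (HL q Hq Hqnz HqL); specialize (HPsi q Hq).
  destruct (height_attained q Hqnz) as (Hh0 & i0 & Hi0 & Hhi); rewrite Hq in Hi0.
  assert (Hh : 0 < IZR (height q)) by (apply (IZR_lt 0); exact Hh0).
  set (a := fun i => IZR (nth i q 0%Z)).
  assert (Hai0 : Rabs (a i0) = IZR (height q)) by (unfold a; rewrite <- abs_IZR, Hhi; reflexivity).
  assert (Ha0 : a i0 <> 0) by (intros H0; rewrite H0, Rabs_R0 in Hai0; lra).
  (* Subtracting this from row [i0] alone makes [q c + p] vanish exactly. *)
  set (delta := fun j => (qX n m q x j + IZR (nth j p 0%Z)) / a i0).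
  set (c := fun k => if Nat.eq_dec (k / m) i0 then x k - delta (k mod m)%nat else x k).
  set (r := Psi q / IZR (height q)).
  assert (Hr : 0 < r) by (apply Rdiv_lt_0_compat; assumption).
  assert (HrPsi : r * IZR (height q) = Psi q) by (unfold r; field; lra).
  assert (Hentry : forall i j, (i < n)%nat -> (j < m)%nat ->
    (i * m + j < n * m)%nat /\ ((i * m + j) / m)%nat = i /\ ((i * m + j) mod m)%nat = j).
  { intros i j Hi Hj; split; [nia|].
    rewrite Nat.div_add_l, Nat.div_small, (Nat.add_comm (i * m)), Nat.Div0.mod_add, Nat.mod_small by lia; lia. }
  assert (Hcj : forall j, (j < m)%nat -> qX n m q c j + IZR (nth j p 0%Z) = 0).
  { intros j Hj; unfold qX.
    rewrite (sumR_ext n _ (fun i => a i * mat_entry m x i j +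
      (-1) * (if Nat.eq_dec i i0 then a i0 * delta j else 0))).
    - rewrite sumR_plus, sumR_scal, sumR_single by exact Hi0.
      change (sumR n (fun i => a i * mat_entry m x i j)) with (qX n m q x j).
      unfold delta; field; exact Ha0.
    - intros i Hi; destruct (Hentry i j Hi Hj) as (_ & Hdiv & Hmod).
      unfold mat_entry, c; rewrite Hdiv, Hmod; fold (a i).
      destruct (Nat.eq_dec i i0) as [->|_]; ring. }
  exists c, r; split; [split; [exact Hr|]|split].
  - apply Rmult_lt_reg_r with (IZR (height q)); lra.
  - intros k Hk; unfold c; destruct (Nat.eq_dec (k / m) i0).
    2: { rewrite Rminus_diag, Rabs_R0; lra. }
    assert (Hkm : (k mod m < m)%nat) by (apply Nat.mod_upper_bound; nia).
    replace (x k - (x k - delta (k mod m)%nat)) with (delta (k mod m)%nat) by ring.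
    unfold delta, r, Rdiv; rewrite Rabs_mult, Rabs_inv, Hai0.
    apply Rmult_le_compat_r; [left; apply Rinv_0_lt_compat, Hh|].
    left; apply Hlt, Hkm.
  (* The same pair [(p, q)], with its coprimality, solves the inequality for [Psi / N] at [y]; an
     exceptional [y] would force both heights to be at most [N]. *)
  - intros y Hy [_ Hey]; apply Hbig, Hey.
    repeat split; try assumption; intros j Hj.
    replace (qX n m q y j + IZR (nth j p 0%Z)) with (qX n m q y j + (-1) * qX n m q c j)
      by (specialize (Hcj j Hj); lra).
    unfold qX; rewrite <- sumR_scal, <- sumR_plus.
    eapply Rle_lt_trans; [apply sumR_abs|].
    set (w := r / (2 * INR n * INR N)) in *.
    (* The [n] terms add up to [Psi q / (2 * N)]; the 2 in the porosity constant makes the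
       inequality strict. *)
    apply Rle_lt_trans with (sumR n (fun _ => IZR (height q) * w)).
    + apply sumR_le; intros i Hi; destruct (Hentry i j Hi Hj) as (Hk & _ & _).
      unfold mat_entry; specialize (Hy _ Hk).
      replace (IZR (nth i q 0%Z) * y (i * m + j)%nat + -1 * (IZR (nth i q 0%Z) * c (i * m + j)%nat))
        with (IZR (nth i q 0%Z) * (y (i * m + j)%nat - c (i * m + j)%nat)) by ring.
      rewrite Rabs_mult, <- abs_IZR.
      apply Rmult_le_compat; try apply Rabs_pos; try exact Hy.
      * apply (IZR_le 0), Z.abs_nonneg.
      * apply IZR_le, height_nth.
    + rewrite sumR_const.
      replace (INR n * (IZR (height q) * w)) with (Psi q / INR N * / 2)
        by (unfold w; rewrite <- HrPsi; field; lra).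
      assert (0 < Psi q / INR N) by (apply Rdiv_lt_0_compat; assumption); lra.
Qed.

Lemma null_set_exceptional (v : variant) (n m : nat) (Psi : list Z -> R) (N : nat) :
  (1 <= m)%nat -> (1 <= n)%nat -> (1 <= N)%nat -> (forall q, length q = n -> 0 < Psi q) ->
  null_set (n * m) (exceptional v n m Psi N).
Proof.
  intros Hm Hn HN HPsi.
  apply null_set_porous with (2 * INR n * INR N).
  - nia.
  - assert (1 <= INR n) by (apply (le_INR 1); exact Hn).
    assert (1 <= INR N) by (apply (le_INR 1); exact HN); nra.
  - intros x Hx; apply Hx.
  - destruct (classic (forall eta, 0 < eta -> exists L, forall q, length q = n ->
      Exists (fun z => z <> 0%Z) q -> ~ In q L -> Psi q < eta * IZR (height q))) as [Hs|Hs].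
    { apply porous_exceptional; assumption. }
    apply not_all_ex_not in Hs; destruct Hs as [eta Hs].
    apply imply_to_and in Hs; destruct Hs as [Heta Hs].
    (* In this case [Psi q >= eta * height q] for infinitely many [q]; the exceptional set is empty
       and porous vacuously. *)
    intros x Hx; exfalso; apply exceptional_not_infinitely_many in Hx; apply Hx.
    apply infinitely_many_solutions_of_large_Psi with eta; try assumption.
    intros L; apply NNPP; intros HL; apply Hs; exists L; intros q Hq Hqnz HqL.
    apply Rnot_le_lt; intros Hle; apply HL; exists q; auto.
Qed.

Theorem theorem3 (m n : nat) (Psi : list Z -> R) (v : variant) :
  (1 <= m)%nat -> (1 <= n)%nat ->
  (forall q : list Z, length q = n -> 0 < Psi q) ->
  same_lebesgue_measure (n * m) (Wset v n m Psi) (Aset v n m Psi).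
Proof.
  intros Hm Hn HPsi c; split; intros H.
  (* Adding countably many null sets to [Wset] recovers [Aset] without raising the bound [c]. *)
  - apply lebesgue_outer_le_subset with
      (fun x => Wset v n m Psi x \/ exists i, exceptional v n m Psi (S i) x).
    + intros x Hx; destruct (classic (Wset v n m Psi x)) as [HW|HW]; [left; exact HW|].
      right; apply not_Wset_exceptional; assumption.
    + apply lebesgue_outer_le_null_union; [exact H|].
      apply null_set_countable_union; intros i.
      apply null_set_exceptional; try assumption; lia.
  - revert H; apply lebesgue_outer_le_subset; intros x HW.
    destruct (HW 1%nat (le_n 1)) as [Hx Hinf]; split; [exact Hx|].
    intros L; destruct (Hinf L) as (pq & Hin & Hs); exists pq; split; [exact Hin|].
    revert Hs; apply solution_weaken; intros q _; simpl; lra.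
Qed.
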